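(* Fix a state $s$, an integer $A\ge 1$, and real numbers $\tau>0$, $\delta>0$. Let $\pi_\beta(\cdot\mid s)$ be a probability density on $\mathbb R^A$, let $Q(s,\cdot):\mathbb R^A\to\mathbb R$ be bounded and measurable, and let $\rho_\delta$ be the density of $\mathcal N(0,\delta^2 I)$ on $\mathbb R^A$. Consider the joint objective $$\mathcal J_s(\pi^{\mathrm{base}},\pi^{\mathrm{ref}})=\mathbb E_{a\sim\pi^{\mathrm{base}}(\cdot\mid s)}\big[\mathcal J_{s,a}(\pi^{\mathrm{ref}})\big]-\frac1\tau\,\mathrm{KL}\big(\pi^{\mathrm{base}}(\cdot\mid s)\,\|\,\pi_\beta(\cdot\mid s)\big),$$ where $$\mathcal J_{s,a}(\pi^{\mathrm{ref}})=\mathbb E_{\Delta a\sim\pi^{\mathrm{ref}}(\cdot\mid s,a)}\big[Q(s,a+\Delta a)\big]-\frac1\tau\,\mathrm{KL}\big(\pi^{\mathrm{ref}}(\cdot\mid s,a)\,\|\,\rho_\delta\big),$$ over all proposal-selection policies $\pi^{\mathrm{base}}(\cdot\mid s)$ and all conditional refinement policies $\pi^{\mathrm{ref}}(\cdot\mid s,\cdot)$. Then $\mathcal J_s$ attains its maximum, and for any maximizing pair the law of the final action $\tilde a=a+\Delta a$, with $a\sim\pi^{\mathrm{base}}(\cdot\mid s)$ and $\Delta a\sim\pi^{\mathrm{ref}}(\cdot\mid s,a)$, has density $$\pi_\delta^\star(\tilde a\mid s)\;\propto\;\bar\pi_{\beta,\delta}(\tilde a\mid s)\,e^{\tau Q(s,\tilde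 a)},\qquad \bar\pi_{\beta,\delta}(\tilde a\mid s)=\int_{\mathbb R^A}\pi_\beta(a\mid s)\,\rho_\delta(\tilde a-a)\,\mathrm da,$$ where $\propto$ denotes equality up to a normalizing constant independent of $\tilde a$.
   Context: A proposal-selection policy $\pi^{\mathrm{base}}(\cdot\mid s)$ is a probability distribution on $\mathbb R^A$. A conditional refinement policy $\pi^{\mathrm{ref}}$ is a Markov (probability) kernel assigning to each proposal $a\in\mathbb R^A$ a probability distribution $\pi^{\mathrm{ref}}(\cdot\mid s,a)$ on $\mathbb R^A$. $\mathrm{KL}(\mu\|\nu)\in[0,\infty]$ is the Kullback–Leibler divergence, equal to $+\infty$ when $\mu$ is not absolutely continuous with respect to $\nu$; in that case the corresponding objective takes the value $-\infty$ (the objectives are bounded above since $Q(s,\cdot)$ is bounded). Densities are with respect to Lebesgue measure. *)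

(* Defs.v *)
From HB Require Import structures.
From mathcomp Require Import all_boot all_order all_algebra.
From mathcomp Require Import all_classical all_reals all_analysis.
From mathcomp Require Import measurable_realfun.
Set Implicit Arguments.
Unset Strict Implicit.
Unset Printing Implicit Defensive.
Import Order.TTheory GRing.Theory Num.Theory.
Import numFieldNormedType.Exports.
Local Open Scope classical_set_scope.
Local Open Scope ring_scope.
Local Open Scope ereal_scope.

Lemma sigma_finite_product_measure1 d1 d2 (T1 : measurableType d1)
    (T2 : measurableType d2) (R : realType)
    (m1 : {sigma_finite_measure set T1 -> \bar R})
    (m2 : {sigma_finite_measure set T2 -> \bar R}) :
  sigma_finite [set: T1 * T2] (m1 \x m2).
Proof.
have /sigma_finiteP[F [TF ndF Foo]] := sigma_finiteT m1.
have /sigma_finiteP[G [TG ndG Goo]] := sigma_finiteT m2.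
exists (fun n => F n `*` G n).
  rewrite -setXTT TF TG predeqE => -[x y]; split.
    move=> [/= [n _ Fnx] [k _ Gky]]; exists (maxn n k) => //; split.
    - by move: x Fnx; exact/subsetPset/ndF/leq_maxl.
    - by move: y Gky; exact/subsetPset/ndG/leq_maxr.
  by move=> [n _ []/= ? ?]; split; exists n.
move=> k; have [? ?] := Foo k; have [? ?] := Goo k.
split; first exact: measurableX.
by rewrite product_measure1E// lte_mul_pinfty// ge0_fin_numE.
Qed.

(* R^n is n.-tuple R with the product sigma-algebra of the library.  Lebesgue
   measure on it is obtained by iterating the binary product:
   lambda_0 is the unit mass at the only point of R^0, and lambda_(n+1) is the
   image of lambda_1 \x lambda_n under (x, t) |-> x :: t. *)

Section lebesgue_step.
Context {R : realType} {n : nat}.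
Variable m : {sigma_finite_measure set (n.-tuple R) -> \bar R}.

Definition cons_pair (p : measurableTypeR R * n.-tuple R) : n.+1.-tuple R :=
  [tuple of (p.1 : R) :: p.2].

Lemma measurable_cons_pair : measurable_fun [set: _] cons_pair.
Proof.
by apply: (@measurable_cons _ _ _ R (fun p => p.1 : R) n snd);
  [exact: measurable_fst|exact: measurable_snd].
Qed.

Definition uncons_pair (t : n.+1.-tuple R) : measurableTypeR R * n.-tuple R :=
  (thead t, [tuple of behead t]).

Lemma measurable_uncons_pair : measurable_fun [set: _] uncons_pair.
Proof.
apply/measurable_fun_pairP; split; last exact: measurable_behead.
exact: (@measurable_tnth _ R n.+1 ord0).
Qed.

Lemma cons_pairK : cancel cons_pair uncons_pair.
Proof. by case=> x t; congr pair; apply/val_inj. Qed.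

Lemma uncons_pairK : cancel uncons_pair cons_pair.
Proof. by move=> t; rewrite [RHS]tuple_eta. Qed.

Definition lebesgue_step : set (n.+1.-tuple R) -> \bar R :=
  pushforward (@lebesgue_measure R \x m) cons_pair.

Let lebesgue_step0 : lebesgue_step set0 = 0.
Proof. by rewrite /lebesgue_step /pushforward preimage_set0 measure0. Qed.

Let lebesgue_step_ge0 A : 0 <= lebesgue_step A.
Proof. by apply: integral_ge0 => x _; exact: measure_ge0. Qed.

Let lebesgue_step_sigma_additive : semi_sigma_additive lebesgue_step.
Proof.
have mpre A : measurable A -> measurable (cons_pair @^-1` A).
  by move=> mA; rewrite -[X in measurable X]setTI; exact: measurable_cons_pair.
move=> F mF tF mUF; rewrite /lebesgue_step /pushforward preimage_bigcup.
apply: (@measure_semi_sigma_additive _ _ _ (@lebesgue_measure R \x m)).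
- by move=> i; exact: mpre.
- apply/trivIsetP => /= i j _ _ ij; rewrite -preimage_setI.
  by move/trivIsetP : tF => /(_ _ _ _ _ ij) ->//; rewrite preimage_set0.
- by rewrite -preimage_bigcup; exact: mpre.
Qed.

HB.instance Definition _ := isMeasure.Build _ _ _ lebesgue_step
  lebesgue_step0 lebesgue_step_ge0 lebesgue_step_sigma_additive.

Let lebesgue_step_sigma_finite : sigma_finite [set: _] lebesgue_step.
Proof.
have [F FT Ffin] :=
  sigma_finite_product_measure1 (@lebesgue_measure R) m.
exists (fun i => uncons_pair @^-1` F i).
  by rewrite -preimage_bigcup -FT preimage_setT.
move=> i; have [mF Foo] := Ffin i; split.
  by rewrite -[X in measurable X]setTI; exact: measurable_uncons_pair.
rewrite /lebesgue_step /pushforward -comp_preimage.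
suff -> : uncons_pair \o cons_pair = idfun by [].
by apply/funext => p; exact: cons_pairK.
Qed.

HB.instance Definition _ := @Measure_isSigmaFinite.Build _ _ _ lebesgue_step
  lebesgue_step_sigma_finite.

End lebesgue_step.

Fixpoint lebesgue_tuple (R : realType) (n : nat) :
    {sigma_finite_measure set (n.-tuple R) -> \bar R} :=
  if n is k.+1 then lebesgue_step (lebesgue_tuple R k)
  else \d_([tuple] : 0.-tuple R).

Section pdf.
Context {R : realType} {n : nat}.
Local Notation leb := (lebesgue_tuple R n).

Record pdf := Pdf {
  pdf_fun :> n.-tuple R -> R ;
  measurable_pdf : measurable_fun [set: n.-tuple R] pdf_fun ;
  pdf_ge0 : forall x, (0 <= pdf_fun x)%R ;
  integral_pdf : \int[leb]_x (pdf_fun x)%:E = 1 }.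

Variable f : pdf.

Definition pdf_law : set (n.-tuple R) -> \bar R :=
  fun U => \int[leb]_(x in U) (f x)%:E.

Let integrable_pdf : leb.-integrable [set: n.-tuple R] (EFin \o f).
Proof.
apply/integrableP; split.
  by apply/measurable_EFinP; exact: (measurable_pdf f).
under eq_integral do rewrite /= ger0_norm ?pdf_ge0//.
by rewrite integral_pdf ltry.
Qed.

Let pdf_law0 : pdf_law set0 = 0.
Proof. by rewrite /pdf_law integral_set0. Qed.

Let pdf_law_ge0 U : 0 <= pdf_law U.
Proof. by apply: integral_ge0 => x _; rewrite lee_fin pdf_ge0. Qed.

Let pdf_law_sigma_additive : semi_sigma_additive pdf_law.
Proof.
move=> U mU tU mUU; rewrite /pdf_law integral_bigcup//=; last first.
  by apply: (integrableS _ _ (subsetT _)) => //; exact: integrable_pdf.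
apply: is_cvg_ereal_nneg_natsum_cond => i _ _.
by apply: integral_ge0 => x _; rewrite lee_fin pdf_ge0.
Qed.

HB.instance Definition _ := isMeasure.Build _ _ _ pdf_law
  pdf_law0 pdf_law_ge0 pdf_law_sigma_additive.

Let pdf_law_setT : pdf_law [set: n.-tuple R] = 1.
Proof. exact: integral_pdf. Qed.

HB.instance Definition _ := @Measure_isProbability.Build _ _ R pdf_law
  pdf_law_setT.

End pdf.
Arguments pdf : clear implicits.

Section gaussian.
Context {R : realType}.

(* density of N(0, delta^2 I) *)
Definition gaussian_fun (delta : R) (n : nat) (x : n.-tuple R) : R :=
  (\prod_(i < n) normal_pdf 0 delta (tnth x i))%R.

Lemma gaussian_funE (delta : R) (n : nat) (x : n.-tuple R) : delta != 0%R ->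
  (gaussian_fun delta x = (Num.sqrt (delta ^+ 2 * pi *+ 2))^-1 ^+ n *
     expR (- (\sum_(i < n) tnth x i ^+ 2) / (delta ^+ 2 *+ 2)))%R.
Proof.
move=> delta0; rewrite /gaussian_fun normal_pdfE//.
rewrite big_split/= prodr_const card_ord -expR_sum; congr (_ * expR _)%R.
rewrite mulNr mulr_suml -sumrN; apply: eq_bigr => i _.
by rewrite subr0 mulNr.
Qed.

Lemma measurable_gaussian_fun delta n :
  measurable_fun [set: n.-tuple R] (@gaussian_fun delta n).
Proof.
apply: measurable_prod => i _.
by apply: measurableT_comp; [exact: measurable_normal_pdf|exact: measurable_tnth].
Qed.

Lemma gaussian_fun_ge0 delta n (x : n.-tuple R) : (0 <= gaussian_fun delta x)%R.
Proof. by apply: prodr_ge0 => i _; exact: normal_pdf_ge0. Qed.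

Lemma integral_gaussian_fun delta n :
  \int[lebesgue_tuple R n]_x (gaussian_fun delta x)%:E = 1.
Proof.
have mg k : measurable_fun [set: k.-tuple R] (EFin \o @gaussian_fun delta k).
  by apply/measurable_EFinP; exact: measurable_gaussian_fun.
elim: n => [|n IHn].
  rewrite /= integral_dirac//= ?diracT ?mul1e; last exact: mg.
  by rewrite /gaussian_fun big_ord0.
pose m := lebesgue_tuple R n.
have g_ge0 k (x : k.-tuple R) : 0 <= (gaussian_fun delta x)%:E.
  by rewrite lee_fin gaussian_fun_ge0.
pose h p := (gaussian_fun delta (@cons_pair R n p))%:E.
have mh : measurable_fun setT h.
  exact: (measurableT_comp (mg n.+1) measurable_cons_pair).
transitivity (\int[@lebesgue_measure R \x m]_p h p).
  rewrite [LHS](@ge0_integral_pushforward _ _ _ _ _ _ measurable_cons_pair) //.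
  exact: mg.
rewrite fubini_tonelli1//; last by move=> p; exact: g_ge0.
have hE x t : h (x, t) = (normal_pdf 0 delta x)%:E * (gaussian_fun delta t)%:E.
  rewrite /h /gaussian_fun big_ord_recl/= EFinM; congr (_%:E * _%:E).
  by apply: eq_bigr => i _; rewrite tnthS; congr (normal_pdf _ _ (tnth _ _));
    exact/val_inj.
under eq_integral => x _.
  rewrite /fubini_F; under eq_integral do rewrite hE.
  rewrite ge0_integralZl ?lee_fin ?normal_pdf_ge0 ?IHn ?mule1//; last exact: mg.
  over.
exact: integral_normal_pdf.
Qed.

Definition gaussian_pdf (delta : R) (n : nat) : pdf R n :=
  Pdf (@measurable_gaussian_fun delta n) (@gaussian_fun_ge0 delta n)
    (integral_gaussian_fun delta n).

End gaussian.

Section probability_kernel_law.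
Context {d d'} {X : measurableType d} {Y : measurableType d'} {R : realType}.
Variables (k : R.-pker X ~> Y) (x : X).

Definition pker_law : set Y -> \bar R := k x.

HB.instance Definition _ := Measure.on pker_law.

Let pker_law_setT : pker_law [set: Y] = 1.
Proof. exact: prob_kernel. Qed.

HB.instance Definition _ :=
  @Measure_isProbability.Build _ _ R pker_law pker_law_setT.

End probability_kernel_law.

Local Open Scope charge_scope.

(* The Radon-Nikodym derivative is nonzero mu-almost everywhere, so the
   convention ln 0 = 0 of the library is harmless; the negative part of the
   integrand is always mu-integrable, so the integral is well defined in
   [0, +oo]. *)
Definition KL d (T : measurableType d) (R : realType)
    (mu nu : probability T R) : \bar R :=
  if `[< mu `<< nu >]
  then \int[mu]_x (ln (fine ('d (charge_of_finite_measure mu) '/d nu x)))%:E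
  else +oo.

Section proposal_refinement.
Context {R : realType} {A : nat}.
Local Notation RA := (A.-tuple R).
Local Notation leb := (lebesgue_tuple R A).
Implicit Types (tau delta : R) (pi_beta : pdf R A) (Q : RA -> R).
Implicit Types (base : probability RA R) (ref : R.-pker RA ~> RA).

Definition addt (x y : RA) : RA := [tuple (tnth x i + tnth y i)%R | i < A].
Definition subt (x y : RA) : RA := [tuple (tnth x i - tnth y i)%R | i < A].

(* J_{s,a}(pi^ref); the state s is fixed throughout and left implicit. *)
Definition refinement_objective tau delta Q ref (a : RA) : \bar R :=
  \int[pker_law ref a]_da (Q (addt a da))%:E
  - tau^-1%:E * KL (pker_law ref a) (pdf_law (gaussian_pdf delta A)).

(* J_s(pi^base, pi^ref).  For Q bounded the integrand is bounded above, so the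
   integral is well defined in [-oo, +oo[ and no +oo - +oo occurs. *)
Definition joint_objective tau delta pi_beta Q base ref : \bar R :=
  \int[base]_a refinement_objective tau delta Q ref a
  - tau^-1%:E * KL base (pdf_law pi_beta).

Definition is_maximizer tau delta pi_beta Q base ref : Prop :=
  forall base' ref', joint_objective tau delta pi_beta Q base' ref'
                     <= joint_objective tau delta pi_beta Q base ref.

(* law of a + da for a ~ base and da ~ ref(a) *)
Definition final_law base ref : set RA -> \bar R :=
  fun U => \int[base]_a pushforward (pker_law ref a) (addt a) U.

Definition smoothed_pdf delta pi_beta (x : RA) : R :=
  (\int[leb]_a (pi_beta a * gaussian_pdf delta A (subt x a)))%R.

Definition has_density (mu : set RA -> \bar R) (f : RA -> R) : Prop :=
  [/\ measurable_fun [set: RA] f, forall x, (0 <= f x)%R &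
      forall U, measurable U -> mu U = \int[leb]_(x in U) (f x)%:E].

End proposal_refinement.

(* Main.v *)
Require Import Defs.
From HB Require Import structures.
From mathcomp Require Import all_boot all_order all_algebra.
From mathcomp Require Import all_classical all_reals all_analysis.
From mathcomp Require Import measurable_realfun.
From mathcomp Require Import ring lra.
Import Order.TTheory GRing.Theory Num.Theory.
Import numFieldNormedType.Exports.
Set Implicit Arguments.
Unset Strict Implicit.
Unset Printing Implicit Defensive.
Local Open Scope classical_set_scope.
Local Open Scope ring_scope.

(* Applying the Gibbs variational inequality
     E_P[F] - KL(P || nu) / tau <= ln (E_nu[exp (tau F)]) / tau
   to the refinement stage and then to the proposal stage bounds the joint
   objective by ln Z / tau, where Z is the joint partition function; the two
   exponential tilts attain the bound.  For a maximizing pair, let p be the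
   probability it gives to an event S.  The same bound for the perturbed reward
   F + (e / tau) 1_S gives e p <= ln (Z_e / Z) <= (exp e - 1) q for every real
   e, where q is the probability of S under the tilted joint law; letting e tend
   to 0 from both sides yields p = q, without identifying the maximizers
   themselves. *)

(** * Monotonicity of the integral for arbitrary functions *)

Section integral_monotone.
Local Open Scope ereal_scope.
Context d (T : measurableType d) (R : realType).
Variables (mu : {measure set T -> \bar R}) (D : set T).

(* Needed without measurability: the divergence of a kernel from a fixed law is
   not shown to depend measurably on the point. *)
Lemma le_integral_nonmeasurable (f g : T -> \bar R) :
  (forall x, D x -> f x <= g x) ->
  \int[mu]_(x in D) f x <= \int[mu]_(x in D) g x.
Proof.
move=> fg.
have fgD x : x \in setT -> (f \_ D) x <= (g \_ D) x.
  by move=> _; exact: lee_restrict.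
rewrite /integral; apply: leeB; apply: le_ereal_sup => _ [h /= hle <-];
  exists h => // x; apply: (le_trans (hle x)).
- by apply: (@funepos_le _ _ setT) => //; rewrite in_setT.
- by apply: (@funeneg_le _ _ setT) => //; rewrite in_setT.
Qed.

End integral_monotone.

(** * Bounded measurable functions *)

Section bounded_measurable.
Context d (T : measurableType d) (R : realType).

(** This class is stable under all operations below and integrable for every finite measure, which
    settles the integrability side conditions at once. *)
Definition bounded_measurable (F : T -> R) :=
  measurable_fun [set: T] F /\ exists M, forall x, `|F x| <= M.

Lemma bounded_measurableD F G : bounded_measurable F -> bounded_measurable G ->
  bounded_measurable (F \+ G).
Proof.
move=> [mF [M FM]] [mG [N GN]]; split; first exact: measurable_funD.
by exists (M + N) => x; rewrite (le_trans (ler_normD _ _))// lerD.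
Qed.

Lemma bounded_measurable_cst c : bounded_measurable (cst c).
Proof. by split => //; exists `|c|. Qed.

Lemma bounded_measurableZ c F : bounded_measurable F ->
  bounded_measurable (fun x => c * F x).
Proof.
move=> [mF [M FM]]; split; first exact: measurable_funM.
by exists (`|c| * M) => x; rewrite normrM ler_wpM2l.
Qed.

Lemma bounded_measurable_indic (S : set T) : measurable S ->
  bounded_measurable (\1_S : T -> R).
Proof.
move=> mS; split; first exact: measurable_indic.
by exists 1 => x; rewrite indicE; case: (x \in S); rewrite ?normr0 ?normr1.
Qed.

Lemma bounded_measurable_expR F : bounded_measurable F ->
  bounded_measurable (expR \o F).
Proof.
move=> [mF [M FM]]; split; first exact: measurableT_comp.
exists (expR M) => x /=; rewrite ger0_norm ?expR_ge0// ler_expR.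
by rewrite (le_trans (ler_norm _)).
Qed.

Lemma bounded_measurable_integrable (mu : {finite_measure set T -> \bar R}) F :
  bounded_measurable F -> mu.-integrable setT (EFin \o F).
Proof.
move=> [mF [M FM]]; apply: measurable_bounded_integrable => //.
  by rewrite ltey_eq fin_num_measure.
exists M; split; first exact: num_real.
by move=> x Mx y _ /=; rewrite (le_trans (FM y))// ltW.
Qed.

End bounded_measurable.

(** * Partition function of a bounded reward *)

Section exp_integral.
Context d (T : measurableType d) (R : realType).
Variable nu : probability T R.

Definition exp_integral (F : T -> R) : R := \int[nu]_x expR (F x).

Lemma bounded_integralE F : bounded_measurable F ->
  (\int[nu]_x (F x)%:E)%E = (\int[nu]_x F x)%:E.
Proof.
move=> bF; rewrite /Rintegral fineK//; apply: integrable_fin_num => //.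
exact: (bounded_measurable_integrable _ bF).
Qed.

Lemma exp_integralE F : bounded_measurable F ->
  (\int[nu]_x (expR (F x))%:E)%E = (exp_integral F)%:E.
Proof. by move/bounded_measurable_expR/bounded_integralE. Qed.

(** Constants integrate to themselves against a probability. Both bounds control [log_partition];
    the lower one also gives positivity. *)
Lemma exp_integral_bounds F M : bounded_measurable F ->
  (forall x, `|F x| <= M) -> expR (- M) <= exp_integral F <= expR M.
Proof.
move=> bF FM; have := exp_integralE bF => E.
have cstE c : (\int[nu]_x c%:E = c%:E)%E.
  by rewrite integral_cst//= probability_setT mule1.
rewrite -!lee_fin -E -(cstE (expR (- M))) -(cstE (expR M)).
by apply/andP; split; apply: le_integral_nonmeasurable => x _;
  rewrite lee_fin ler_expR; have := FM x; rewrite ler_norml => /andP[].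
Qed.

Lemma exp_integral_gt0 F : bounded_measurable F -> 0 < exp_integral F.
Proof.
move=> bF; case: (bF) => _ [M FM].
have /andP[+ _] := exp_integral_bounds bF FM.
by apply: lt_le_trans; exact: expR_gt0.
Qed.

End exp_integral.

(** * Gibbs variational inequality *)

Section gibbs.
Context d (T : measurableType d) (R : realType).
Variable nu : probability T R.
Local Open Scope ereal_scope.
Local Open Scope charge_scope.

(** Let [r] be the density of [P] and [G] = F - ln Z, so that e^G has [nu]-integral 1. The tangent
    bound ln (e^G / r) <= e^G / r - 1 is integrated against [P], where e^G / r has integral at most
    1. *)
Lemma gibbs_le (P : probability T R) (F : T -> R) : bounded_measurable F ->
  ((\int[P]_x F x)%R - ln (exp_integral nu F))%:E <= KL P nu.
Proof.
move=> bF; rewrite /KL; case: asboolP => [Pnu|_]; last by rewrite leey.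
set f := 'd _ '/d _; pose r x := fine (f x).
pose G x := (F x - ln (exp_integral nu F))%R.
have bG : bounded_measurable G.
  exact: bounded_measurableD bF (bounded_measurable_cst _ _).
have mG : measurable_fun setT G by case: bG.
have mf : measurable_fun setT f by rewrite /f.
have frE x : f x = (r x)%:E by rewrite fineK// Radon_Nikodym_fin_num.
have mr : measurable_fun setT r.
  by apply/measurable_EFinP; apply: eq_measurable_fun mf => x _; rewrite /= frE.
(* On [N] the logarithm of [r] takes its default value 0. This set is [P]-null, because its mass is
   the integral of [r] over it. *)
pose N := [set x | (r x <= 0)%R].
have mN : measurable N.
  rewrite (_ : N = r @^-1` `]-oo, 0%R]); last first.
    by apply/seteqP; split => x /=; rewrite in_itv.
  by rewrite -[X in measurable X]setTI; apply: mr.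
have PN0 : P N = 0.
  apply/eqP; rewrite eq_le measure_ge0 andbT.
  rewrite -[P N]/(charge_of_finite_measure P N).
  rewrite (@Radon_Nikodym_integral _ _ _ (charge_of_finite_measure P) nu)//.
  rewrite -(@integral0 _ _ _ nu N); apply: le_integral_nonmeasurable => x.
  by rewrite -/f frE lee_fin.
pose p x : R := \1_(~` N) x.
(* [k] is e^G / r where [r] is positive and 0 on [N]. *)
pose k x := (p x * expR (G x - ln (r x)))%R.
have pE x : p x = (if (0 < r x)%R then 1 else 0)%R.
  rewrite /p indicE; case: ifPn => h.
    by rewrite mem_set//= /N/=; apply/negP; rewrite -ltNge.
  by rewrite memNset//= /N /= => /negP; rewrite -ltNge => /(negP h).
have k0 x : (0 <= k x)%R.
  by rewrite /k pE; case: ifPn => _; rewrite ?mul0r// mul1r expR_ge0.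
have mp : measurable_fun setT p by apply: measurable_indic; exact: measurableC.
have mk : measurable_fun setT k.
  apply: measurable_funM => //; apply: measurableT_comp => //.
  by apply: measurable_funB => //; exact: measurableT_comp.
(* Passing to [nu] turns [k] into k r, which is e^G off [N] and 0 on [N]. Only an inequality
   results, as [N] may carry [nu]-mass. *)
have intk : \int[P]_x (k x)%:E <= 1.
  have ek0 x : 0 <= (k x)%:E by rewrite lee_fin.
  have mek : measurable_fun setT (EFin \o k) by exact/measurable_EFinP.
  rewrite -(Radon_Nikodym_SigmaFinite.change_of_variables Pnu ek0 measurableT mek).
  have <- : \int[nu]_x (expR (G x))%:E = 1.
    under eq_integral do rewrite /G expRD EFinM muleC.
    rewrite integralZl//; last first.
      exact: (bounded_measurable_integrable _ (bounded_measurable_expR bF)).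
    rewrite exp_integralE// -EFinM expRN lnK ?posrE ?exp_integral_gt0//.
    by rewrite mulVf// gt_eqF// exp_integral_gt0.
  have mg : measurable_fun setT (Radon_Nikodym_SigmaFinite.f P nu).
    exact: measurable_int (Radon_Nikodym_SigmaFinite.f_integrable _).
  apply: ae_ge0_le_integral => //.
  - by move=> x _; rewrite mule_ge0 ?lee_fin// Radon_Nikodym_SigmaFinite.f_ge0.
  - by apply: emeasurable_funM => //; exact/measurable_EFinP.
  - by apply/measurable_EFinP; exact: measurableT_comp.
  - have := ae_eq_Radon_Nikodym_SigmaFinite Pnu measurableT.
    apply: filterS => x /(_ I) -> _.
    rewrite -/f frE -EFinM lee_fin /k pE; case: ifPn => h.
      by rewrite mul1r expRD expRN lnK ?posrE// divfK// gt_eqF.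
    by rewrite !mul0r expR_ge0.
have ik : P.-integrable setT (EFin \o k).
  apply/integrableP; split; first exact/measurable_EFinP.
  under eq_integral => x _ do rewrite /= ger0_norm//.
  by rewrite (le_lt_trans intk)// ltry.
pose G1 x := (p x * (G x + 1))%R.
have bG1 : bounded_measurable G1.
  split; first by apply: measurable_funM => //; exact: measurable_funD.
  case: bG => _ [M GM]; exists (M + 1)%R => x.
  rewrite /G1 pE; case: ifPn => _; rewrite ?mul1r ?mul0r.
    by rewrite (le_trans (ler_normD _ _))// normr1 lerD.
  by rewrite normr0 addr_ge0// (le_trans _ (GM x)).
have iG1 := bounded_measurable_integrable P bG1.
have -> : ((\int[P]_x F x)%R - ln (exp_integral nu F))%:E = \int[P]_x (G x)%:E.
  under [RHS]eq_integral do rewrite /G EFinB.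
  rewrite integralB//=; last 2 first.
  - exact: (bounded_measurable_integrable P bF).
  - exact: finite_measure_integrable_cst.
  by rewrite bounded_integralE// integral_cst//= probability_setT mule1.
(* ln r >= G + 1 - e^G / r wherever r > 0; elsewhere both sides are 0. *)
apply: (@le_trans _ _ (\int[P]_x (G1 x - k x)%:E)); last first.
  apply: le_integral_nonmeasurable => x _; rewrite lee_fin -/f -/(r x).
  rewrite /G1 /k pE; case: ifPn => h; last by rewrite !mul0r subr0 ln0// leNgt.
  rewrite !mul1r; have := expR_ge1Dx (G x - ln (r x)).
  lra.
under [leRHS]eq_integral do rewrite EFinB.
rewrite integralB//=.
(* [G1] and G + 1 differ only on the null set [N]. *)
have -> : \int[P]_x (G1 x)%:E = \int[P]_x (G x)%:E + 1.
  transitivity (\int[P]_x ((G x)%:E + 1)); last first.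
    rewrite integralD//=; last 2 first.
    - exact: (bounded_measurable_integrable P bG).
    - exact: finite_measure_integrable_cst.
    by rewrite integral_cst//= probability_setT mule1.
  apply: ae_eq_integral => //.
  - by apply/measurable_EFinP; case: bG1.
  - by apply/measurable_EFinP; exact: measurable_funD.
  - exists N; split => // x /=; apply: contra_notP => h _.
    by rewrite /G1 pE ltNge; move/negP : h => ->; rewrite mul1r EFinD.
rewrite bounded_integralE// -EFinD.
have kfin : \int[P]_x (k x)%:E \is a fin_num.
  rewrite ge0_fin_numE ?integral_ge0// => [|x _]; rewrite ?lee_fin//.
  by rewrite (le_lt_trans intk)// ltry.
move: intk; rewrite -(fineK kfin) -EFinB !lee_fin; lra.
Qed.

End gibbs.

(** * Measures given by a density *)

Section density.
Local Open Scope ereal_scope.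
Local Open Scope charge_scope.
Context d (T : measurableType d) (R : realType).
Variables (P : {finite_measure set T -> \bar R}).
Variables (m : {sigma_finite_measure set T -> \bar R}) (f : T -> R).
Hypothesis mf : measurable_fun setT f.
Hypothesis PE : forall U, measurable U -> P U = \int[m]_(x in U) (f x)%:E.

Lemma density_dominates : P `<< m.
Proof.
apply/null_content_dominatesP => U mU mU0; rewrite PE// null_set_integral//.
by apply/measurable_EFinP; exact: measurable_funTS.
Qed.

(** Two integrable functions with equal integrals over every measurable set agree almost
    everywhere. *)
Lemma density_Radon_Nikodym :
  ae_eq m setT ('d (charge_of_finite_measure P) '/d m) (EFin \o f).
Proof.
have Pm := density_dominates; apply: integral_ae_eq => //.
- exact: Radon_Nikodym_integrable.
- exact/measurable_EFinP.
- by move=> U _ mU; rewrite -Radon_Nikodym_integral//; exact: PE.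
Qed.

(** The library change of variables uses its own version of the derivative, which equals [f] almost
    everywhere. *)
Lemma ge0_integral_density (g : T -> \bar R) :
  (forall x, 0 <= g x) -> measurable_fun setT g ->
  \int[P]_x g x = \int[m]_x (g x * (f x)%:E).
Proof.
move=> g0 mg; have Pm := density_dominates.
have mef : measurable_fun setT (EFin \o f) by exact/measurable_EFinP.
have mr : measurable_fun setT (Radon_Nikodym_SigmaFinite.f P m).
  exact: measurable_int (Radon_Nikodym_SigmaFinite.f_integrable Pm).
rewrite -(Radon_Nikodym_SigmaFinite.change_of_variables Pm)//.
apply: ae_eq_integral => //; [exact: emeasurable_funM..|].
apply: ae_eqe_mul2l; apply: ae_eq_trans density_Radon_Nikodym.
exact: ae_eq_Radon_Nikodym_SigmaFinite.
Qed.

End density.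

(** * Exponential tilts and equality in the Gibbs inequality *)

Section gibbs_law.
Local Open Scope ereal_scope.
Context d (T : measurableType d) (R : realType).
Variable nu : probability T R.

(** This is e^F / Z with the constant kept in the exponent, so that its logarithm simplifies
    directly. *)
Definition gibbs_density (F : T -> R) (x : T) : R :=
  expR (F x - ln (exp_integral nu F)).

Lemma bounded_measurable_gibbs_density F :
  bounded_measurable F -> bounded_measurable (gibbs_density F).
Proof.
move=> bF; apply: bounded_measurable_expR.
exact: bounded_measurableD bF (bounded_measurable_cst _ _).
Qed.

Variables (F : T -> R) (bF : bounded_measurable F).

(* The proof argument lets the measure instances be inferred. *)
Definition gibbs_law (_ : bounded_measurable F) (U : set T) : \bar R :=
  \int[nu]_(x in U) (gibbs_density F x)%:E.

Let gibbs_law0 : gibbs_law bF set0 = 0.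
Proof. by rewrite /gibbs_law integral_set0. Qed.

Let gibbs_law_ge0 U : 0 <= gibbs_law bF U.
Proof. by apply: integral_ge0 => x _; rewrite lee_fin expR_ge0. Qed.

Let gibbs_law_sigma_additive : semi_sigma_additive (gibbs_law bF).
Proof.
move=> U mU tU mUU; rewrite /gibbs_law integral_bigcup//=; last first.
  apply: (integrableS _ _ (subsetT _)) => //.
  exact/bounded_measurable_integrable/bounded_measurable_gibbs_density.
apply: is_cvg_ereal_nneg_natsum_cond => i _ _.
by apply: integral_ge0 => x _; rewrite lee_fin expR_ge0.
Qed.

HB.instance Definition _ := isMeasure.Build _ _ _ (gibbs_law bF)
  gibbs_law0 gibbs_law_ge0 gibbs_law_sigma_additive.

Let gibbs_law_setT : gibbs_law bF setT = 1.
Proof.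
rewrite /gibbs_law; under eq_integral do rewrite /gibbs_density expRD EFinM muleC.
rewrite integralZl//; last first.
  exact: (bounded_measurable_integrable _ (bounded_measurable_expR bF)).
rewrite exp_integralE// -EFinM expRN lnK ?posrE ?exp_integral_gt0//.
by rewrite mulVf// gt_eqF// exp_integral_gt0.
Qed.

HB.instance Definition _ := @Measure_isProbability.Build _ _ R (gibbs_law bF)
  gibbs_law_setT.

(** The log-density of the tilt is F - ln Z. Agreement on measurable sets is the form in which the
    values of [pker_law] are supplied. *)
Lemma KL_gibbs_law (P : probability T R) :
  (forall U, measurable U -> P U = gibbs_law bF U) ->
  KL P nu = ((\int[P]_x F x)%R - ln (exp_integral nu F))%:E.
Proof.
move=> PE.
have [mG _] := bounded_measurable_gibbs_density bF.
have Pnu : P `<< nu := density_dominates mG PE.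
rewrite /KL asboolT//; set f := Radon_Nikodym _ _.
have mf : measurable_fun setT f.
  exact: measurable_int (Radon_Nikodym_integrable _).
have -> : ((\int[P]_x F x)%R - ln (exp_integral nu F))%:E =
    \int[P]_x (F x - ln (exp_integral nu F))%:E.
  under [RHS]eq_integral do rewrite EFinB.
  rewrite integralB//=; last 2 first.
  - exact: (bounded_measurable_integrable P bF).
  - exact: finite_measure_integrable_cst.
  by rewrite bounded_integralE// integral_cst//= probability_setT mule1.
apply: ae_eq_integral => //.
- apply/measurable_EFinP; apply: measurableT_comp => //.
  exact: measurableT_comp.
- by apply/measurable_EFinP; case: bF => mF _; exact: measurable_funB.
(* The exceptional set is [nu]-null, hence [P]-null by domination. *)
- have [A [mA A0 sA]] := density_Radon_Nikodym mG PE.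
  exists A; split => //; first by move/null_content_dominatesP : Pnu; exact.
  move=> x /= nx; apply: sA => /= fx; apply: nx => _.
  by rewrite /f fx//= /gibbs_density expRK.
Qed.

End gibbs_law.

(** * Exponential tilts as a probability kernel *)

Section gibbs_kernel.
Local Open Scope ereal_scope.
Context d d' (X : measurableType d) (Y : measurableType d') (R : realType).
Variables (nu : probability Y R) (F : X * Y -> R).

Lemma bounded_measurable_section x :
  bounded_measurable F -> bounded_measurable (fun y => F (x, y)).
Proof.
move=> [mF [M FM]]; split; first exact: measurableT_comp.
by exists M => y; exact: FM.
Qed.

(** Up to the factor 1 / tau, this is the optimal refinement value at [x]; it becomes the reward of
    the proposal stage. *)
Definition log_partition x : R := ln (exp_integral nu (fun y => F (x, y))).

(** Measurability is that of a partial integral in Tonelli's theorem; a bound on [F] carries over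
    through the bounds on [exp_integral]. *)
Lemma bounded_measurable_log_partition :
  bounded_measurable F -> bounded_measurable log_partition.
Proof.
move=> bF; split.
  apply: measurableT_comp => //.
  apply/measurable_EFinP.
  rewrite (_ : _ \o _ = fubini_F nu (fun z => (expR (F z))%:E)).
    apply: measurable_fun_fubini_tonelli_F => //.
    by apply/measurable_EFinP; apply: measurableT_comp => //; case: bF.
  apply/funext => x; rewrite /fubini_F /=.
  by rewrite -exp_integralE//; exact: bounded_measurable_section.
case: (bF) => _ [M FM]; exists M => x.
have bx := bounded_measurable_section x bF.
have /andP[lo hi] := exp_integral_bounds nu bx (fun y => FM (x, y)).
have Z0 := exp_integral_gt0 nu bx.
rewrite ler_norml -[(- M)%R]expRK -[X in _ && (_ <= X)%R]expRK.
by rewrite !ler_ln ?posrE ?expR_gt0// lo.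
Qed.

Hypothesis bF : bounded_measurable F.

Definition gibbs_kernel (x : X) : {measure set Y -> \bar R} :=
  gibbs_law nu (bounded_measurable_section x bF).

(** The mass of [U] is the partial integral of one jointly measurable function, the density times
    the indicator of [U]. *)
Let measurable_gibbs_kernel U : measurable U ->
  measurable_fun [set: X] (gibbs_kernel ^~ U).
Proof.
move=> mU.
pose g (z : X * Y) := (expR (F z - log_partition z.1) * \1_U z.2)%:E.
rewrite (_ : gibbs_kernel ^~ U = fubini_F nu g).
  apply: measurable_fun_fubini_tonelli_F.
    apply/measurable_EFinP; apply: measurable_funM; apply: measurableT_comp => //.
    apply: measurable_funB; first by case: bF.
    by apply: measurableT_comp => //; case: (bounded_measurable_log_partition bF).
  by move=> z; rewrite lee_fin mulr_ge0 ?expR_ge0// indicE.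
apply/funext => x; rewrite /gibbs_kernel /= /gibbs_law /fubini_F.
rewrite [LHS]integral_mkcond epatch_indic.
by apply: eq_integral => y _; rewrite /= /g /= EFinM.
Qed.

HB.instance Definition _ :=
  isKernel.Build _ _ _ _ R gibbs_kernel measurable_gibbs_kernel.

Let gibbs_kernel_setT x : gibbs_kernel x [set: Y] = 1.
Proof.
exact: (@probability_setT _ _ _
  (gibbs_law nu (bounded_measurable_section x bF))).
Qed.

HB.instance Definition _ :=
  Kernel_isProbability.Build _ _ _ _ R gibbs_kernel gibbs_kernel_setT.

End gibbs_kernel.

(** Both sides of the bound vanish at e = 0, so comparing slopes from the right and from the left
    forces equality. *)
Lemma eq_of_expR_bound (R : realType) (p q : R) : 0 <= p <= 1 -> 0 <= q ->
  (forall e, e * p <= (expR e - 1) * q) -> p = q.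
Proof.
move=> /andP[p0 p1] q0 pq.
(* exp e <= 1 / (1 - e) linearizes the hypothesis. *)
have key e : e < 1 -> (1 - e) * (e * p) <= e * q.
  move=> e1; have e10 : 0 < 1 - e by lra.
  have h : (1 - e) * expR e <= 1.
    rewrite -(@ler_pM2r _ (expR (- e))) ?expR_gt0// -mulrA -expRD subrr expR0.
    by have := expR_ge1Dx (- e); lra.
  rewrite (le_trans (ler_wpM2l (ltW e10) (pq e)))// mulrA ler_wpM2r//.
  by lra.
apply/eqP; rewrite eq_le; apply/andP; split; rewrite leNgt; apply/negP => lt.
(* Dividing [key] by [e] gives p - q <= e p <= e, which contradicts e = (p - q) / 2. The other case
   is symmetric, with [- e]. *)
- pose e := (p - q) / 2; have e0 : 0 < e by rewrite /e; lra.
  have := key e; rewrite mulrCA ler_pM2l// => /(_ ltac:(rewrite /e; lra)).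
  have : e * p <= e by rewrite ler_piMr// ltW.
  by rewrite /e; lra.
- pose e := (q - p) / 2; have e0 : 0 < e by rewrite /e; lra.
  have := key (- e); rewrite mulrCA ler_nM2l ?oppr_lt0// => /(_ ltac:(lra)).
  have : e * p <= e by rewrite ler_piMr// ltW.
  by rewrite /e; lra.
Qed.

(** * Two-stage maximization on arbitrary spaces *)

Section two_stage.
Local Open Scope ereal_scope.
Context d d' (X : measurableType d) (Y : measurableType d') (R : realType).
Variables (tau : R) (mu : probability X R) (nu : probability Y R).
Hypothesis tau_gt0 : (0 < tau)%R.

Lemma scaled_gibbs_le d0 (T : measurableType d0) (m P : probability T R)
    (F : T -> R) : bounded_measurable F ->
  \int[P]_x (F x)%:E - tau^-1%:E * KL P m <=
    (tau^-1 * ln (exp_integral m (fun x => tau * F x)))%:E.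
Proof.
move=> bF; have bG := bounded_measurableZ tau bF.
have := gibbs_le m P bG.
rewrite bounded_integralE//.
have -> : (\int[P]_x (tau * F x) = tau * \int[P]_x F x)%R.
  by rewrite RintegralZl//; exact: (bounded_measurable_integrable P bF).
case: (KL P m) => [k| |] //.
- rewrite -EFinM -EFinB !lee_fin => h.
  by rewrite -(ler_pM2l tau_gt0) mulrBr !mulrA divff ?gt_eqF// !mul1r; lra.
- by rewrite gt0_muley ?lte_fin ?invr_gt0// addeNy leNye.
Qed.

(** [G] is kept apart from tau F because at the proposal stage [G] is [log_partition] and [F] is its
    multiple by 1 / tau. *)
Lemma scaled_gibbs_law d0 (T : measurableType d0) (m P : probability T R)
    (F G : T -> R) (bG : bounded_measurable G) : (forall x, G x = tau * F x)%R ->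
  (forall U, measurable U -> P U = gibbs_law m bG U) ->
  \int[P]_x (F x)%:E - tau^-1%:E * KL P m = (tau^-1 * ln (exp_integral m G))%:E.
Proof.
move=> GE PE; rewrite (KL_gibbs_law PE).
have bF : bounded_measurable F.
  rewrite (_ : F = (fun x => tau^-1 * G x)%R); first exact: bounded_measurableZ.
  by apply/funext => x; rewrite GE mulrA mulVf ?mul1r// gt_eqF.
rewrite bounded_integralE//.
have -> : (\int[P]_x G x = tau * \int[P]_x F x)%R.
  rewrite (_ : G = (fun x => tau * F x)%R); last exact/funext.
  by rewrite RintegralZl//; exact: (bounded_measurable_integrable P bF).
rewrite -EFinM -EFinB; congr EFin.
by rewrite mulrBr mulrA mulVf ?gt_eqF// mul1r; ring.
Qed.

Definition two_stage_objective (F : X * Y -> R) (base : probability X R)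
    (ref : R.-pker X ~> Y) : \bar R :=
  \int[base]_x (\int[pker_law ref x]_y (F (x, y))%:E
                - tau^-1%:E * KL (pker_law ref x) nu)
  - tau^-1%:E * KL base mu.

Definition joint_partition (G : X * Y -> R) : R :=
  exp_integral mu (log_partition nu G).

(** The exponential undoes the logarithm in [log_partition], leaving an iterated integral for
    Tonelli's theorem. *)
Lemma joint_partitionE G : bounded_measurable G ->
  (joint_partition G)%:E = \int[mu \x nu]_z (expR (G z))%:E.
Proof.
move=> bG; rewrite /joint_partition -exp_integralE; last first.
  exact: bounded_measurable_log_partition.
rewrite fubini_tonelli1.
- apply: eq_integral => x _; rewrite /fubini_F.
  have bx := bounded_measurable_section x bG.
  by rewrite lnK ?posrE ?exp_integral_gt0// -exp_integralE.
- by apply/measurable_EFinP; case: (bounded_measurable_expR bG).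
- by move=> z; rewrite lee_fin expR_ge0.
Qed.

Lemma joint_partition_gt0 G : bounded_measurable G -> (0 < joint_partition G)%R.
Proof. by move/(bounded_measurable_log_partition nu)/exp_integral_gt0; exact. Qed.

Variable F : X * Y -> R.
Hypothesis bF : bounded_measurable F.

Let bG : bounded_measurable (fun z => tau * F z)%R := bounded_measurableZ tau bF.

(** The semidirect product of [base] and [ref], that is, the joint law of proposal and
    refinement. *)
Definition pair_law (base : probability X R) (ref : R.-pker X ~> Y)
    (S : set (X * Y)) : \bar R := \int[base]_x ref x (xsection S x).

Section pair_law.
Variables (base : probability X R) (ref : R.-pker X ~> Y) (S : set (X * Y)).
Hypothesis mS : measurable S.

Let p x := fine (ref x (xsection S x)).

Let prob01 x U : measurable U -> 0 <= ref x U <= 1.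
Proof.
move=> mU; rewrite measure_ge0 /=.
by rewrite -(@prob_kernel _ _ _ _ _ ref x) le_measure// inE.
Qed.

Let pE x : ref x (xsection S x) = (p x)%:E.
Proof.
have /andP[h0 h1] := prob01 x (measurable_xsection x mS).
by rewrite /p fineK// ge0_fin_numE// (le_lt_trans h1)// ltry.
Qed.

Let p01 x : (0 <= p x <= 1)%R.
Proof. by rewrite -!lee_fin -pE prob01//; exact: measurable_xsection. Qed.

Let bp : bounded_measurable p.
Proof.
split.
  apply/measurable_EFinP; rewrite (_ : _ \o _ = (fun x => ref x (xsection S x))).
    by apply: measurable_fun_xsection_finite_kernel; rewrite inE.
  by apply/funext => x /=; rewrite pE.
by exists 1%R => x; have /andP[h0 h1] := p01 x; rewrite ger0_norm.
Qed.

Lemma pair_lawE : pair_law base ref S = (fine (pair_law base ref S))%:E.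
Proof.
rewrite fineK// /pair_law; under eq_integral do rewrite pE.
by rewrite bounded_integralE.
Qed.

Lemma pair_law01 : (0 <= fine (pair_law base ref S) <= 1)%R.
Proof.
rewrite -!lee_fin -pair_lawE; apply/andP; split.
  by apply: integral_ge0 => x _; exact: measure_ge0.
have <- : \int[base]_x (1%R)%:E = 1.
  by rewrite integral_cst//= probability_setT mule1.
apply: le_integral_nonmeasurable => x _.
by have /andP[] := prob01 x (measurable_xsection x mS).
Qed.

(** The Gibbs inequality is used at both stages for the reward F + (e / tau) 1_S, and the
    expectation of the added term is moved to the right. The case e = 0 is the plain upper bound. *)
Lemma two_stage_objective_le (e : R) :
  two_stage_objective F base ref <=
    (tau^-1 * (ln (joint_partition (fun z => tau * F z + e * \1_S z))
               - e * fine (pair_law base ref S)))%:E%R.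
Proof.
set G := (fun z => tau * F z + e * \1_S z)%R.
have bS := bounded_measurable_indic R mS.
have bGe : bounded_measurable G.
  exact: bounded_measurableD bG (bounded_measurableZ e bS).
pose W := log_partition nu G.
have bW : bounded_measurable W by exact: bounded_measurable_log_partition.
have inner x : \int[pker_law ref x]_y (F (x, y))%:E
    - tau^-1%:E * KL (pker_law ref x) nu <= (tau^-1 * W x - (tau^-1 * e) * p x)%:E.
  have bx := bounded_measurable_section x bF.
  have bSx := bounded_measurable_section x bS.
  have bx' := bounded_measurableD bx (bounded_measurableZ (tau^-1 * e) bSx).
  have := scaled_gibbs_le nu (pker_law ref x) bx'.
  have -> : (fun y => tau * (F (x, y) + tau^-1 * e * \1_S (x, y)))%R =
      (fun y => G (x, y)).
    by apply/funext => y; rewrite mulrDr !mulrA divff ?gt_eqF// mul1r.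
  rewrite -/(log_partition nu G x) -/(W x).
  under eq_integral do rewrite EFinD EFinM.
  rewrite integralD//=; last 2 first.
  - exact: bounded_measurable_integrable bx.
  - apply: integrableZl => //; exact: bounded_measurable_integrable bSx.
  rewrite integralZl//=; last exact: bounded_measurable_integrable bSx.
  have -> : \int[pker_law ref x]_y (\1_S (x, y))%:E = (p x)%:E.
    rewrite -pE -[xsection S x]setIT -integral_indic//; last first.
      exact: measurable_xsection.
    by apply: eq_integral => y _; rewrite !indicE mem_xsection.
  rewrite bounded_integralE// => h; rewrite EFinB leeBrDr// EFinM addeAC.
  exact: h.
have bp' := bounded_measurableZ (tau^-1 * e) bp.
have bW' := bounded_measurableZ tau^-1 bW.
have outer := scaled_gibbs_le mu base bW'.
have int_inner : \int[base]_x (tau^-1 * W x - (tau^-1 * e) * p x)%:E =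
    \int[base]_x (tau^-1 * W x)%:E - (tau^-1 * (e * fine (pair_law base ref S)))%:E.
  under eq_integral do rewrite EFinB.
  rewrite integralB//=; last 2 first.
  - exact: bounded_measurable_integrable bW'.
  - exact: bounded_measurable_integrable bp'.
  rewrite EFinN; congr (_ - _); under eq_integral do rewrite EFinM.
  rewrite integralZl//=; last exact: bounded_measurable_integrable bp.
  rewrite mulrA [in RHS]EFinM -pair_lawE /pair_law; congr (_ * _).
  by apply: eq_integral => x _; rewrite pE.
have := @le_integral_nonmeasurable _ _ _ base setT _ _ (fun x _ => inner x).
rewrite int_inner /two_stage_objective => h.
apply: (le_trans (leeB h (lexx _))).
(* The proposal stage has reward W / tau, so its scaled partition function is the joint one. *)
have WE : joint_partition G = exp_integral mu (fun x => tau * (tau^-1 * W x))%R.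
  by congr exp_integral; apply/funext => x; rewrite mulrA divff ?mul1r// gt_eqF.
move: outer; rewrite -WE mulrBr.
move: (tau^-1 * (e * fine _))%R (tau^-1 * ln _)%R (tau^-1%:E * KL _ _) => c z K.
rewrite bounded_integralE// -EFinB; case: K => [k| |] //.
- by rewrite -!EFinB !lee_fin; lra.
- by move=> _; rewrite addeNy leNye.
Qed.

End pair_law.

Definition optimal_base : probability X R :=
  gibbs_law mu (bounded_measurable_log_partition nu bG).
Definition optimal_refinement : R.-pker X ~> Y := gibbs_kernel nu bG.

Lemma two_stage_objective_optimal :
  two_stage_objective F optimal_base optimal_refinement =
    (tau^-1 * ln (joint_partition (fun z => tau * F z)))%:E%R.
Proof.
rewrite /two_stage_objective /joint_partition.
pose W := log_partition nu (fun z => tau * F z)%R.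
have inner x : \int[pker_law optimal_refinement x]_y (F (x, y))%:E
    - tau^-1%:E * KL (pker_law optimal_refinement x) nu = (tau^-1 * W x)%:E.
  by apply: (scaled_gibbs_law (bG := bounded_measurable_section x bG)).
under eq_integral do rewrite inner.
apply: (scaled_gibbs_law (bG := bounded_measurable_log_partition nu bG)) => // x.
by rewrite mulrA divff ?mul1r// gt_eqF.
Qed.

Lemma optimal_maximizes base ref :
  two_stage_objective F base ref <=
    two_stage_objective F optimal_base optimal_refinement.
Proof.
have := two_stage_objective_le base ref measurable0 0.
rewrite two_stage_objective_optimal mul0r subr0.
rewrite (_ : (fun z => tau * F z + 0 * \1_set0 z)%R = (fun z => tau * F z)%R)//.
by apply/funext => z; rewrite mul0r addr0.
Qed.

(** First-order condition at a maximizer, tested in the direction 1_S. *)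
Lemma maximizer_pair_law base ref :
  (forall base' ref', two_stage_objective F base' ref' <=
    two_stage_objective F base ref) ->
  forall S, measurable S -> pair_law base ref S =
    (joint_partition (fun z => tau * F z)%R)^-1%:E *
    \int[mu \x nu]_z (expR (tau * F z) * \1_S z)%:E.
Proof.
move=> mx S mS; have := joint_partitionE bG.
have := joint_partition_gt0 bG; have := two_stage_objective_optimal.
move: (joint_partition (fun z => tau * F z)%R) => Z0 optE Z00 Z0E.
have bS := bounded_measurable_indic R mS.
have [mE _] := bounded_measurable_expR bG.
pose g (z : X * Y) := (expR (tau * F z) * \1_S z)%R.
have g0 z : (0 <= g z)%R by rewrite mulr_ge0 ?expR_ge0// indicE.
have mg : measurable_fun setT g by apply: measurable_funM => //; case: bS.
set I := \int[mu \x nu]_z _.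
have I0 : 0 <= I by apply: integral_ge0 => z _; rewrite lee_fin; exact: g0.
have IZ : I <= Z0%:E.
  rewrite Z0E; apply: le_integral_nonmeasurable => z _.
  by rewrite lee_fin ler_piMr ?expR_ge0// indicE; case: (_ \in _).
have Ifin : I \is a fin_num by rewrite ge0_fin_numE// (le_lt_trans IZ)// ltry.
(* The perturbation multiplies the weight by exp e on [S] and leaves it unchanged elsewhere. Placing
   [I] on the left avoids subtraction, so additivity of nonnegative integrals suffices. *)
have key e : (joint_partition (fun z => tau * F z + e * \1_S z)%R)%:E + I =
    Z0%:E + (expR e)%:E * I.
  have bGe : bounded_measurable (fun z => tau * F z + e * \1_S z)%R.
    exact: bounded_measurableD bG (bounded_measurableZ e bS).
  have [mGe _] := bounded_measurable_expR bGe.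
  have eg0 z : (0 <= expR e * g z)%R by rewrite mulr_ge0 ?expR_ge0.
  have meg : measurable_fun setT (fun z => expR e * g z)%R by exact: measurable_funM.
  have -> : (expR e)%:E * I = \int[mu \x nu]_z (expR e * g z)%:E.
    rewrite -(@ge0_integralZl_EFin _ _ _ (mu \x nu) setT measurableT (EFin \o g))//.
    - by move=> z _; rewrite lee_fin.
    - exact/measurable_EFinP.
  have addE (u v : X * Y -> R) : measurable_fun setT u -> measurable_fun setT v ->
      (forall z, 0 <= u z)%R -> (forall z, 0 <= v z)%R ->
      \int[mu \x nu]_z (u z)%:E + \int[mu \x nu]_z (v z)%:E =
      \int[mu \x nu]_z (u z + v z)%:E.
    move=> mu1 mv u0 v0; under [RHS]eq_integral do rewrite EFinD.
    rewrite ge0_integralD//.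
    - by move=> z _; rewrite lee_fin.
    - exact/measurable_EFinP.
    - by move=> z _; rewrite lee_fin.
    - exact/measurable_EFinP.
  have H1 := addE _ _ mGe mg (fun=> expR_ge0 _) g0.
  have H2 := addE _ _ mE meg (fun=> expR_ge0 _) eg0.
  rewrite (joint_partitionE bGe) Z0E.
  apply: (eq_trans H1); apply: (eq_trans _ (esym H2)).
  apply: eq_integral => z _; congr EFin; rewrite /g /= expRD indicE.
  by case: (_ \in _); rewrite ?mulr1 ?mulr0 ?expR0; ring.
move: I I0 IZ Ifin Z0E key => I I0 _ Ifin _ key.
rewrite pair_lawE// -(fineK Ifin) -EFinM; congr EFin.
apply: eq_of_expR_bound.
- exact: pair_law01.
- by apply: mulr_ge0; [rewrite invr_ge0 ltW|exact: fine_ge0].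
move=> e.
(* Maximality bounds the value below by ln Z0 / tau and the perturbed bound caps it, so ln Z0 <= ln
   Ze - e p. *)
have := key e; have := le_trans (mx optimal_base optimal_refinement)
  (two_stage_objective_le base ref mS e).
rewrite optE lee_fin ler_pM2l ?invr_gt0//.
have : (0 < joint_partition (fun z => tau * F z + e * \1_S z))%R.
  apply: joint_partition_gt0.
  exact: bounded_measurableD bG (bounded_measurableZ e bS).
move: (joint_partition _) => Ze Ze0 h.
rewrite -(fineK Ifin) -EFinM -!EFinD => -[ZeE].
(* This is ln y <= y - 1 at y = Ze / Z0. *)
have := expR_ge1Dx (ln (Ze / Z0)).
rewrite lnK ?posrE ?divr_gt0// ln_div ?posrE// => h'.
have -> : ((expR e - 1) * (Z0^-1 * fine I) = Ze / Z0 - 1)%R.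
  have -> : (Ze = Z0 + expR e * fine I - fine I)%R by rewrite -ZeE addrK.
  by field; rewrite gt_eqF.
by lra.
Qed.

End two_stage.

(** * Translation invariance of Lebesgue measure on tuples *)

Section translation.
Local Open Scope ereal_scope.
Context {R : realType}.

(** Lebesgue measure is determined by its values on half-open intervals, whose length a shift
    preserves. *)
Lemma lebesgue_measure_translation (c : R) (U : set (measurableTypeR R)) :
  measurable U ->
  pushforward (@lebesgue_measure R) (+%R c : _ -> measurableTypeR R) U =
  lebesgue_measure U.
Proof.
move=> mU; apply/esym/lebesgue_measure_unique => //=.
  exact: measurable_funD.
move=> _ _ [[a b]] _ <-.
have tE : (+%R c : R -> R) @^-1` [set` `]a, b]%R] = [set` `]a - c, b - c]%R].
  by apply/seteqP; split => x /=; rewrite !in_itv/= ltrBlDl lerBrDl.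
rewrite /pushforward tE.
rewrite !lebesgue_measure_itv/= !lte_fin ltrD2r; case: ifPn => // _.
by rewrite -!EFinB; congr EFin; ring.
Qed.

Lemma ge0_integral_translation (c : R) (g : measurableTypeR R -> \bar R) :
  (forall x, 0 <= g x) -> measurable_fun setT g ->
  \int[@lebesgue_measure R]_x g (c + x)%R = \int[@lebesgue_measure R]_x g x.
Proof.
move=> g0 mg.
have mt : measurable_fun setT (+%R c : measurableTypeR R -> measurableTypeR R).
  exact: measurable_funD.
rewrite -(@ge0_integral_pushforward _ _ _ _ _ _ mt _ setT)//.
by apply: eq_measure_integral => U mU _; exact: lebesgue_measure_translation.
Qed.

Lemma ge0_integral_lebesgue_tupleS n (g : n.+1.-tuple R -> \bar R) :
  (forall x, 0 <= g x) -> measurable_fun setT g ->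
  \int[lebesgue_tuple R n.+1]_x g x =
  \int[@lebesgue_measure R]_x \int[lebesgue_tuple R n]_t g (cons_pair (x, t)).
Proof.
move=> g0 mg.
rewrite [LHS](@ge0_integral_pushforward _ _ _ _ _ _ measurable_cons_pair)//.
rewrite preimage_setT fubini_tonelli1//; last by move=> p; exact: g0.
by apply: measurableT_comp => //; exact: measurable_cons_pair.
Qed.

Lemma measurable_addt n d (T : measurableType d) (u v : T -> n.-tuple R) :
  measurable_fun setT u -> measurable_fun setT v ->
  measurable_fun setT (fun x => addt (u x) (v x)).
Proof.
move=> /measurable_fun_tnthP mu /measurable_fun_tnthP mv.
apply/measurable_fun_tnthP => i.
rewrite (_ : _ \o _ = (fun x => tnth (u x) i + tnth (v x) i)%R).
  exact: measurable_funD (mu i) (mv i).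
by apply/funext => x; rewrite /= tnth_mktuple.
Qed.

Lemma measurable_subt n d (T : measurableType d) (u v : T -> n.-tuple R) :
  measurable_fun setT u -> measurable_fun setT v ->
  measurable_fun setT (fun x => subt (u x) (v x)).
Proof.
move=> /measurable_fun_tnthP mu /measurable_fun_tnthP mv.
apply/measurable_fun_tnthP => i.
rewrite (_ : _ \o _ = (fun x => tnth (u x) i - tnth (v x) i)%R).
  exact: measurable_funB (mu i) (mv i).
by apply/funext => x; rewrite /= tnth_mktuple.
Qed.

Lemma addtK n (x y : n.-tuple R) : subt (addt x y) x = y.
Proof. by apply: eq_from_tnth => i; rewrite !tnth_mktuple addrC addKr. Qed.

Lemma addt_cons_pair n (a : n.+1.-tuple R) (x : R) (t : n.-tuple R) :
  addt a (cons_pair (x, t)) =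
  cons_pair (thead a + x, addt [tuple of behead a] t)%R.
Proof.
case/tupleP: a => a0 a; apply: eq_from_tnth => i; rewrite tnth_mktuple theadE.
have -> : [tuple of behead [tuple of a0 :: a]] = a by exact/val_inj.
case: (unliftP ord0 i) => [j|] ->; last by rewrite !tnth0.
by rewrite !tnthS tnth_mktuple.
Qed.

(** Induction on the dimension: the tail is shifted by the induction hypothesis, then the head by
    one-dimensional invariance. Dimension 0 has a single point. *)
Lemma ge0_integral_addt n (a : n.-tuple R) (g : n.-tuple R -> \bar R) :
  (forall x, 0 <= g x) -> measurable_fun setT g ->
  \int[lebesgue_tuple R n]_x g (addt a x) = \int[lebesgue_tuple R n]_x g x.
Proof.
elim: n a g => [|n IH] a g g0 mg.
  by apply: eq_integral => x _; congr g; rewrite tuple0 [RHS]tuple0.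
have maddt : measurable_fun setT (addt a) by exact: measurable_addt.
have mgc : measurable_fun setT (fun p => g (cons_pair p)).
  by apply: measurableT_comp => //; exact: measurable_cons_pair.
rewrite !ge0_integral_lebesgue_tupleS//; last exact: measurableT_comp.
pose H x := \int[lebesgue_tuple R n]_t g (cons_pair (x, t)).
transitivity (\int[@lebesgue_measure R]_x H (thead a + x)%R).
  apply: eq_integral => x _; rewrite /H.
  rewrite -(IH [tuple of behead a] (fun t => g (cons_pair (_, t))))//.
    by apply: eq_integral => t _; rewrite addt_cons_pair.
  by apply: (measurableT_comp mgc); exact: measurable_pair1.
apply: ge0_integral_translation.
  by move=> x; exact: integral_ge0.
exact: (measurable_fun_fubini_tonelli_F (fun p => g (cons_pair p))).
Qed.

End translation.

(** * Gaussian smoothing of the proposal density *)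

Section smoothing.
Local Open Scope ereal_scope.
Context {R : realType} {A : nat}.
Variables (delta : R) (pi_beta : pdf R A).
Hypothesis delta_neq0 : delta != 0%R.
Local Notation leb := (lebesgue_tuple R A).

Lemma gaussian_fun_le n (x : n.-tuple R) :
  (gaussian_fun delta x <= normal_peak delta ^+ n)%R.
Proof.
rewrite -[X in (_ ^+ X)%R]card_ord -prodr_const; apply: ler_prod => i _.
by rewrite normal_pdf_ge0 normal_pdf_ub.
Qed.

Let kernel_ge0 (y a : A.-tuple R) :
  0 <= (pi_beta a * gaussian_pdf delta A (subt y a))%:E.
Proof. by rewrite lee_fin mulr_ge0 ?pdf_ge0. Qed.

Let measurable_smoothing_kernel : measurable_fun setT
  (fun z : A.-tuple R * A.-tuple R =>
    (pi_beta z.2 * gaussian_pdf delta A (subt z.1 z.2))%:E).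
Proof.
apply/measurable_EFinP; apply: measurable_funM.
  by apply: measurableT_comp => //; exact: measurable_pdf.
apply: measurableT_comp; first exact: measurable_pdf.
exact: measurable_subt.
Qed.

(** The real integral is a finite part, so finiteness has to be shown: the Gaussian is at most its
    peak and [pi_beta] has mass 1. *)
Lemma smoothed_pdfE y : (smoothed_pdf delta pi_beta y)%:E =
  \int[leb]_a (pi_beta a * gaussian_pdf delta A (subt y a))%:E.
Proof.
rewrite /smoothed_pdf /Rintegral fineK// ge0_fin_numE; last first.
  by apply: integral_ge0 => a _; exact: kernel_ge0.
apply: (@le_lt_trans _ _
  (\int[leb]_a ((normal_peak delta ^+ A)%:E * (pi_beta a)%:E))).
  apply: le_integral_nonmeasurable => a _.
  by rewrite -EFinM lee_fin mulrC ler_wpM2r ?pdf_ge0// gaussian_fun_le.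
rewrite ge0_integralZl_EFin ?integral_pdf ?mule1 ?ltry//.
- by move=> a _; rewrite lee_fin pdf_ge0.
- by apply/measurable_EFinP; exact: measurable_pdf.
- by rewrite exprn_ge0// normal_peak_ge0.
Qed.

Lemma smoothed_pdf_ge0 y : (0 <= smoothed_pdf delta pi_beta y)%R.
Proof.
by rewrite -lee_fin smoothed_pdfE; apply: integral_ge0 => a _; exact: kernel_ge0.
Qed.

Lemma measurable_smoothed_pdf : measurable_fun setT (smoothed_pdf delta pi_beta).
Proof.
apply/measurable_EFinP.
rewrite (_ : _ \o _ = fubini_F leb (fun z : A.-tuple R * A.-tuple R =>
    (pi_beta z.2 * gaussian_pdf delta A (subt z.1 z.2))%:E)).
  apply: measurable_fun_fubini_tonelli_F => //.
by apply/funext => y; rewrite /= smoothed_pdfE.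
Qed.

(** Convolution formula for a sum of independent variables: pass to densities, substitute y = a + x,
    and exchange the integrals. *)
Lemma integral_pdf_addt (phi : A.-tuple R -> R) :
  measurable_fun setT phi -> (forall y, 0 <= phi y)%R ->
  \int[pdf_law pi_beta \x pdf_law (gaussian_pdf delta A)]_z (phi (addt z.1 z.2))%:E =
  \int[leb]_y (smoothed_pdf delta pi_beta y * phi y)%:E.
Proof.
move=> mphi phi0.
pose rho : pdf R A := gaussian_pdf delta A.
have mrho : measurable_fun setT rho by exact: measurable_pdf.
have mbeta : measurable_fun setT pi_beta by exact: measurable_pdf.
have madd a : measurable_fun setT (fun x : A.-tuple R => addt a x).
  exact: measurable_addt.
have mF : measurable_fun setT
    (fun z : A.-tuple R * A.-tuple R => (phi (addt z.1 z.2))%:E).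
  apply/measurable_EFinP; apply: measurableT_comp => //.
  exact: measurable_addt.
have F0 (z : A.-tuple R * A.-tuple R) : 0 <= (phi (addt z.1 z.2))%:E.
  by rewrite lee_fin.
pose h (z : A.-tuple R * A.-tuple R) :=
  (phi z.2 * (pi_beta z.1 * rho (subt z.2 z.1)))%:E.
have mh : measurable_fun setT h.
  apply/measurable_EFinP; apply: measurable_funM; first exact: measurableT_comp.
  apply: measurable_funM; first exact: measurableT_comp.
  by apply: measurableT_comp => //; exact: measurable_subt.
have h0 z : 0 <= h z by rewrite lee_fin mulr_ge0// mulr_ge0// pdf_ge0.
rewrite fubini_tonelli1//.
rewrite (@ge0_integral_density _ _ _ (pdf_law pi_beta) leb pi_beta)//; last 2 first.
- by move=> a; apply: integral_ge0 => x _.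
- exact: measurable_fun_fubini_tonelli_F.
transitivity (\int[leb]_a \int[leb]_y h (a, y)).
  apply: eq_integral => a _; rewrite /fubini_F.
  rewrite (@ge0_integral_density _ _ _ (pdf_law rho) leb rho)//; last first.
    by apply/measurable_EFinP; apply: measurableT_comp => //; exact: madd.
  transitivity ((\int[leb]_y (phi y * rho (subt y a))%:E) * (pi_beta a)%:E).
    (* Translation invariance performs the substitution y = a + x, under which y - a returns to
       x. *)
    congr (_ * _); rewrite -[RHS](ge0_integral_addt a); first last.
    - apply/measurable_EFinP; apply: measurable_funM => //.
      by apply: measurableT_comp => //; exact: measurable_subt.
    - by move=> y; rewrite lee_fin mulr_ge0// pdf_ge0.
    by apply: eq_integral => x _; rewrite addtK EFinM.
  rewrite muleC -ge0_integralZl_EFin ?pdf_ge0//; first last.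
  - apply/measurable_EFinP; apply: measurable_funM => //.
    by apply: measurableT_comp => //; exact: measurable_subt.
  - by move=> y _; rewrite lee_fin mulr_ge0// pdf_ge0.
  by apply: eq_integral => y _; rewrite -EFinM /h /= mulrCA.
rewrite fubini_tonelli//; apply: eq_integral => y _.
rewrite /h /=; under eq_integral do rewrite EFinM.
rewrite ge0_integralZl_EFin//; first by rewrite -smoothed_pdfE -EFinM mulrC.
- by move=> a _; exact: kernel_ge0.
- apply/measurable_EFinP; apply: measurable_funM => //.
  by apply: measurableT_comp => //; exact: measurable_subt.
Qed.

End smoothing.

(** * The concrete objective as a two-stage problem *)

Section final_law.
Local Open Scope ereal_scope.
Context {R : realType} {A : nat}.
Local Notation RA := (A.-tuple R).

Lemma joint_objectiveE tau delta (pi_beta : pdf R A) Q base ref :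
  joint_objective tau delta pi_beta Q base ref =
  two_stage_objective tau (pdf_law pi_beta) (pdf_law (gaussian_pdf delta A))
    (fun z => Q (addt z.1 z.2)) base ref.
Proof. by []. Qed.

(** The section at [a] of the preimage of [U] under addition is the set of x with a + x in [U]. *)
Lemma final_lawE (base : probability RA R) (ref : R.-pker RA ~> RA) U :
  final_law base ref U = pair_law base ref ((fun z => addt z.1 z.2) @^-1` U).
Proof.
apply: eq_integral => a _; rewrite /pushforward /pker_law; congr (ref a _).
by apply/seteqP; split => x; rewrite /xsection /= inE.
Qed.

End final_law.

(** * Existence of a maximizer and density of the final action *)

Theorem proposition3p1 (R : realType) (A : nat) (tau delta : R)
    (pi_beta : pdf R A) (Q : A.-tuple R -> R)
    (A_gt0 : (1 <= A)%N) (tau_gt0 : 0 < tau) (delta_gt0 : 0 < delta)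
    (Q_meas : measurable_fun [set: A.-tuple R] Q)
    (Q_bounded : exists M : R, forall x, `|Q x| <= M) :
  (exists (base : probability (A.-tuple R) R)
          (ref : R.-pker (A.-tuple R) ~> (A.-tuple R)),
      is_maximizer tau delta pi_beta Q base ref) /\
  (forall (base : probability (A.-tuple R) R)
          (ref : R.-pker (A.-tuple R) ~> (A.-tuple R)),
      is_maximizer tau delta pi_beta Q base ref ->
      exists2 c : R, 0 < c &
        has_density (final_law base ref)
          (fun x => c * (smoothed_pdf delta pi_beta x * expR (tau * Q x)))).
Proof.
have delta_neq0 : delta != 0 by rewrite gt_eqF.
pose F (z : A.-tuple R * A.-tuple R) := Q (addt z.1 z.2).
have madd : measurable_fun setT
  (fun z : A.-tuple R * A.-tuple R => addt z.1 z.2) by exact: measurable_addt.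
have bF : bounded_measurable F.
  split; first exact: measurableT_comp.
  by have [M QM] := Q_bounded; exists M => z; exact: QM.
have mexpQ : measurable_fun setT (fun x => expR (tau * Q x)).
  by apply: measurableT_comp => //; exact: measurable_funM.
pose mu := pdf_law pi_beta; pose nu := pdf_law (gaussian_pdf delta A).
split.
  exists (optimal_base tau mu nu bF), (optimal_refinement tau nu bF) => base' ref'.
  rewrite !joint_objectiveE; exact: optimal_maximizes.
move=> base ref mx.
have bG := bounded_measurableZ tau bF.
have Z0 := joint_partition_gt0 mu nu bG.
pose c := (joint_partition mu nu (fun z => tau * F z))^-1.
have c0 : 0 < c by rewrite invr_gt0.
have mdens : measurable_fun setT
    (fun x => c * (smoothed_pdf delta pi_beta x * expR (tau * Q x))).
  apply: measurable_funM => //; apply: measurable_funM => //.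
  exact: measurable_smoothed_pdf.
exists c => //; split => // [x|U mU].
  apply: mulr_ge0; first exact: ltW.
  by rewrite mulr_ge0 ?expR_ge0// smoothed_pdf_ge0.
rewrite final_lawE (maximizer_pair_law (mu := mu) (nu := nu) tau_gt0 bF)//;
    last first.
  by rewrite -[X in measurable X]setTI; exact: madd.
have mphi : measurable_fun setT (fun x => expR (tau * Q x) * \1_U x).
  by apply: measurable_funM => //; exact: measurable_indic.
have phi0 x : 0 <= expR (tau * Q x) * \1_U x.
  by rewrite mulr_ge0 ?expR_ge0// indicE.
(* The weight and the indicator depend on the sum a + x alone, so the convolution formula applies to
   exp (tau Q) 1_U. *)
rewrite (integral_pdf_addt _ _ mphi phi0)// -/c.
rewrite -ge0_integralZl_EFin ?ltW//; first last.
- apply/measurable_EFinP; apply: measurable_funM => //.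
  exact: measurable_smoothed_pdf.
- by move=> x _; rewrite lee_fin mulr_ge0// smoothed_pdf_ge0.
rewrite [RHS]integral_mkcond epatch_indic; apply: eq_integral => x _.
by rewrite /= -!EFinM !mulrA.
Qed.
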